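(* Let $n\ge 2$, let $P=(p_1,\dots,p_n)$, $Q=(q_1,\dots,q_n)\in\Gamma_n$, and let $r,R$ be real numbers with $0<r\le \frac{p_i}{q_i}\le R<\infty$ for all $i\in\{1,\dots,n\}$. Then for every real $s\le -1$, $$\frac{r^{-s}(3r+1)}{(r+1)^2}\,\Phi_s(P\|Q)\ \le\ D(Q\|P)\ \le\ \frac{R^{-s}(3R+1)}{(R+1)^2}\,\Phi_s(P\|Q),$$ and for every real $s\ge \frac14$, $$\frac{R^{-s}(3R+1)}{(R+1)^2}\,\Phi_s(P\|Q)\ \le\ D(Q\|P)\ \le\ \frac{r^{-s}(3r+1)}{(r+1)^2}\,\Phi_s(P\|Q).$$
   Context: For $n\ge2$, $\Gamma_n=\{P=(p_1,\dots,p_n): p_i>0,\ \sum_{i=1}^n p_i=1\}$. For $P,Q\in\Gamma_n$ and $s\in\mathbb{R}$, the relative information of type $s$ is $\Phi_s(P\|Q)=[s(s-1)]^{-1}\left[\sum_{i=1}^n p_i^s q_i^{1-s}-1\right]$ for $s\ne 0,1$; $\Phi_0(P\|Q)=\sum_{i=1}^n q_i\ln\frac{q_i}{p_i}$; $\Phi_1(P\|Q)=\sum_{i=1}^n p_i\ln\frac{p_i}{q_i}$. The adjoint of the relative J-divergence is $D(Q\|P)=\sum_{i=1}^n (q_i-p_i)\ln\left(\frac{p_i+q_i}{2p_i}\right)$. *)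

(* Defs.v *)
From HB Require Import structures.
From mathcomp Require Import all_boot all_order all_algebra.
From mathcomp Require Import all_classical all_reals all_analysis.

Set Implicit Arguments.
Unset Strict Implicit.
Unset Printing Implicit Defensive.
Import Order.TTheory GRing.Theory Num.Theory.
Local Open Scope classical_set_scope.
Local Open Scope ring_scope.

Definition Gamma (K : realType) (n : nat) : set ('I_n -> K) :=
  [set P | (forall i, 0 < P i) /\ \sum_i P i = 1].

Definition Phi (K : realType) (n : nat) (s : K) (P Q : 'I_n -> K) : K :=
  if s == 0 then \sum_i Q i * ln (Q i / P i)
  else if s == 1 then \sum_i P i * ln (P i / Q i)
  else (s * (s - 1))^-1 * (\sum_i (P i) `^ s * (Q i) `^ (1 - s) - 1).

(* [relJ P Q] is the relative J-divergence D(P||Q); its adjoint D(Q||P) is the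
   same functional with the two arguments swapped, [relJ Q P]. *)
Definition relJ (K : realType) (n : nat) (P Q : 'I_n -> K) : K :=
  \sum_i (P i - Q i) * ln ((Q i + P i) / (2 * Q i)).

(* Main.v *)
Require Import Defs.
From HB Require Import structures.
From mathcomp Require Import all_boot all_order all_algebra.
From mathcomp Require Import all_classical all_reals all_analysis.
From mathcomp Require Import ring lra.

Set Implicit Arguments.
Unset Strict Implicit.
Unset Printing Implicit Defensive.
Import Order.TTheory GRing.Theory Num.Theory.
Local Open Scope classical_set_scope.
Local Open Scope ring_scope.

(** Write [x = P i / Q i].  Both functionals are Csiszar divergences
    [\sum_i Q i * f (P i / Q i)]: [relJ Q P] comes from
    [f x = (1 - x) * ln ((x + 1) / (2 * x))], and [Phi s P Q], for [s != 0], from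
    a generator whose second derivative is [x `^ (s - 2)] (the case [s = 1]
    included).  A Csiszar divergence whose generator vanishes at [1] and is
    convex on [[r, R]] is nonnegative: the weights [Q i] average the ratios
    [P i / Q i] to [1], so the divergence dominates the value at [1] of the
    tangent line there ([csiszar_ge0]).  Applied to [f - a g] and [b g - f],
    this says that bounds [a g'' <= f'' <= b g''] on [[r, R]] pass to the
    divergences ([csiszar_compare]).

    Here the quotient of the second derivatives is
    [ratio s x = x `^ (- s) * (3 * x + 1) / (x + 1) ^+ 2], whose logarithmic
    derivative times [x] is
    [- s + x * (1 - 3 * x) / ((3 * x + 1) * (x + 1))].  The last fraction lies
    between [-1] and [1 / 4] for [x > 0], so [ratio s] is nondecreasing when
    [s <= -1] and nonincreasing when [s >= 1 / 4]; its extreme values on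
    [[r, R]], taken at the end points, are the constants of the theorem. *)

(** * Monotonicity and tangent lines on the positive half-line *)

Lemma mvt_pos (K : realType) (f f' : K -> K) :
  (forall x : K, 0 < x -> is_derive x 1 f (f' x)) ->
  forall a b : K, 0 < a -> a <= b ->
  exists2 c, a <= c <= b & f b - f a = f' c * (b - a).
Proof.
move=> df a b a0 ab.
have [x xab|x|c cab ->] := @MVT_segment K f f' a b ab.
- by apply: df; rewrite (lt_le_trans a0)// (itvP xab).
- apply: derivable_within_continuous => y yab.
  by have [|//] := df y; rewrite (lt_le_trans a0)// (itvP yab).
- by exists c; rewrite // -in_itv.
Qed.

Lemma nondecreasing_pos (K : realType) (f f' : K -> K) (a b : K) :
  (forall x : K, 0 < x -> is_derive x 1 f (f' x)) -> 0 < a -> a <= b ->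
  (forall x, a <= x <= b -> 0 <= f' x) -> f a <= f b.
Proof.
move=> df a0 ab f'0; have [c cab fE] := mvt_pos df a0 ab.
by rewrite -subr_ge0 fE mulr_ge0 ?f'0// subr_ge0.
Qed.

(** On [[r, R]] the derivative [f'] is nondecreasing, and by the mean value
    theorem [f x - f 1] is [x - 1] times a value of [f'] between [1] and [x].
    Convexity is required on [[r, R]] only, since the bounds by the end values
    of a monotone quotient hold only there. *)
Lemma tangent_le (K : realType) (f f' f'' : K -> K) (r R x : K) :
  (forall t : K, 0 < t -> is_derive t 1 f (f' t)) ->
  (forall t : K, 0 < t -> is_derive t 1 f' (f'' t)) ->
  (forall t : K, r <= t <= R -> 0 <= f'' t) ->
  0 < r -> r <= 1 <= R -> r <= x <= R ->
  f 1 + f' 1 * (x - 1) <= f x.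
Proof.
move=> df df' f''0 r0 /andP[r1 R1] /andP[rx xR].
have f'_le u v : r <= u -> u <= v -> v <= R -> f' u <= f' v.
  move=> ru uv vR; apply: (nondecreasing_pos df') => //.
    exact: lt_le_trans ru.
  by move=> t /andP[ut tv]; apply: f''0; rewrite (le_trans ru)//= (le_trans tv).
have x0 : 0 < x by exact: lt_le_trans rx.
have [x1|/ltW x1] := leP 1 x.
- have [c /andP[c1 cx] E] := mvt_pos df ltr01 x1.
  rewrite -lerBrDl E ler_wpM2r ?subr_ge0// f'_le//; exact: le_trans xR.
- have [c /andP[xc c1] E] := mvt_pos df x0 x1.
  have := f'_le _ _ (le_trans rx xc) c1 R1; nra.
Qed.

(** * Csiszar divergences *)

Definition csiszar (K : realType) (n : nat) (f : K -> K) (P Q : 'I_n -> K) : K :=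
  \sum_i Q i * f (P i / Q i).

(** The average of the ratios [P i / Q i] with weights [Q i] is [1], so the
    tangent point [1] belongs to any interval containing all the ratios. *)
Lemma ratio_bounds1 (K : realType) (n : nat) (P Q : 'I_n -> K) (r R : K) :
  Gamma P -> Gamma Q -> (forall i, r <= P i / Q i <= R) -> r <= 1 <= R.
Proof.
move=> [P0 P1] [Q0 Q1] PQ; rewrite -P1.
rewrite -[X in X <= _]mulr1 -[X in _ && (_ <= X)]mulr1 -Q1 !mulr_sumr.
by apply/andP; split; apply: ler_sum => i _; have /andP[] := PQ i;
  rewrite ler_pdivlMr// ler_pdivrMr.
Qed.

(** Jensen's inequality, in the form given by the tangent line at [1]. *)
Lemma csiszar_ge0 (K : realType) (n : nat) (P Q : 'I_n -> K) (r R : K)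
    (f f' f'' : K -> K) :
  Gamma P -> Gamma Q -> 0 < r -> (forall i, r <= P i / Q i <= R) ->
  (forall t : K, 0 < t -> is_derive t 1 f (f' t)) ->
  (forall t : K, 0 < t -> is_derive t 1 f' (f'' t)) ->
  (forall t : K, r <= t <= R -> 0 <= f'' t) ->
  f 1 = 0 -> 0 <= csiszar f P Q.
Proof.
move=> hP hQ r0 PQ df df' f''0 f1.
have rR1 := ratio_bounds1 hP hQ PQ; case: hP hQ => [P0 P1] [Q0 Q1].
(* The linear part of the tangent at [1] has zero average. *)
have <- : \sum_i Q i * (f' 1 * (P i / Q i - 1)) = 0.
  transitivity (\sum_i (f' 1 * P i - f' 1 * Q i)).
    by apply: eq_bigr => i _; field; rewrite gt_eqF.
  by rewrite sumrB -!mulr_sumr P1 Q1 subrr.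
apply: ler_sum => i _; apply: ler_wpM2l; first exact: ltW.
by have := tangent_le df df' f''0 r0 rR1 (PQ i); rewrite f1 add0r.
Qed.

Lemma csiszar_lin (K : realType) (n : nat) (P Q : 'I_n -> K) (f g : K -> K) a b :
  csiszar (fun x => a * f x + b * g x) P Q = a * csiszar f P Q + b * csiszar g P Q.
Proof.
rewrite /csiszar !mulr_sumr -big_split/=; apply: eq_bigr => i _.
ring.
Qed.

(** Pointwise comparison of second derivatives carries over to divergences,
    because [f - a g] and [b g - f] are convex. *)
Lemma csiszar_compare (K : realType) (n : nat) (P Q : 'I_n -> K) (r R a b : K)
    (f f' f'' g g' g'' : K -> K) :
  Gamma P -> Gamma Q -> 0 < r -> (forall i, r <= P i / Q i <= R) ->
  (forall t : K, 0 < t -> is_derive t 1 f (f' t)) ->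
  (forall t : K, 0 < t -> is_derive t 1 f' (f'' t)) ->
  (forall t : K, 0 < t -> is_derive t 1 g (g' t)) ->
  (forall t : K, 0 < t -> is_derive t 1 g' (g'' t)) ->
  f 1 = 0 -> g 1 = 0 ->
  (forall t : K, r <= t <= R -> a * g'' t <= f'' t <= b * g'' t) ->
  a * csiszar g P Q <= csiszar f P Q <= b * csiszar g P Q.
Proof.
move=> hP hQ r0 PQ df df' dg dg' f1 g1 H.
have lin c d : (forall t : K, r <= t <= R -> 0 <= c * f'' t + d * g'' t) ->
    0 <= c * csiszar f P Q + d * csiszar g P Q.
  move=> cd; rewrite -csiszar_lin.
  apply: (@csiszar_ge0 _ _ P Q r R _ (c \*: f' + d \*: g') (c \*: f'' + d \*: g'')) => //.
  - by move=> t t0; apply: is_deriveD; apply: is_deriveZ; auto.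
  - by move=> t t0; apply: is_deriveD; apply: is_deriveZ; auto.
  - by rewrite f1 g1 !mulr0 addr0.
have := lin 1 (- a); have := lin (- 1) b.
rewrite !mul1r !mulN1r !mulNr addrC !subr_ge0 => H1 H2.
apply/andP; split.
- by apply: H2 => t /H /andP[]; rewrite mul1r mulNr subr_ge0.
- by apply: H1 => t /H /andP[_]; rewrite mulN1r addrC subr_ge0.
Qed.

(** * The generator of the adjoint relative J-divergence *)

(** The logarithm of [(x + 1) / (2 * x)] is split so that the derivatives are
    sums of elementary ones. *)
Definition relJ_gen (K : realType) (x : K) : K :=
  (1 - x) * (ln (x + 1) - ln 2 - ln x).
Definition relJ_gen' (K : realType) (x : K) : K :=
  (1 - x) * ((x + 1)^-1 - x^-1) - (ln (x + 1) - ln 2 - ln x).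
Definition relJ_gen'' (K : realType) (x : K) : K :=
  (3 * x + 1) / (x ^+ 2 * (x + 1) ^+ 2).

Lemma is_derive_lnD1 (K : realType) (x : K) :
  0 < x -> is_derive x 1 (fun y : K => ln (y + 1)) (x + 1)^-1.
Proof.
move=> x0.
have dln : is_derive (x + 1) 1 (@ln K) (x + 1)^-1 by apply: is_derive1_ln; lra.
have dD1 := is_deriveD (is_derive_id x 1) (is_derive_cst (1 : K) x 1).
apply: is_derive_eq (is_derive1_comp (g := id + cst 1) dln dD1) _.
by rewrite addr0 mulr1.
Qed.

Lemma is_derive_relJ_gen (K : realType) (x : K) : 0 < x ->
  is_derive x 1 (@relJ_gen K) (relJ_gen' x).
Proof.
move=> x0.
have d1B := is_deriveB (is_derive_cst (1 : K) x 1) (is_derive_id x 1).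
have dL := is_deriveB (is_deriveB (is_derive_lnD1 x0)
  (is_derive_cst (ln 2) x 1)) (is_derive1_ln x0).
apply: is_derive_eq (is_deriveM d1B dL) _.
change ((1 - x) * ((x + 1)^-1 - 0 - x^-1)
  + (ln (x + 1) - ln 2 - ln x) * (0 - 1) = relJ_gen' x).
rewrite /relJ_gen'; ring.
Qed.

Lemma is_derive_relJ_gen' (K : realType) (x : K) : 0 < x ->
  is_derive x 1 (@relJ_gen' K) (relJ_gen'' x).
Proof.
move=> x0.
have d1B := is_deriveB (is_derive_cst (1 : K) x 1) (is_derive_id x 1).
have dL := is_deriveB (is_deriveB (is_derive_lnD1 x0)
  (is_derive_cst (ln 2) x 1)) (is_derive1_ln x0).
have dD1 := is_deriveD (is_derive_id x 1) (is_derive_cst (1 : K) x 1).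
have dVD1 := is_deriveV (f := id + cst 1) (lt0r_neq0 (addr_gt0 x0 ltr01)) dD1.
have dV := is_deriveV (lt0r_neq0 x0) (is_derive_id x 1).
apply: is_derive_eq (is_deriveB (is_deriveM d1B (is_deriveB dVD1 dV)) dL) _.
change ((1 - x) * (- (x + 1) ^- 2 * (1 + 0) - - x ^- 2 * 1)
  + ((x + 1)^-1 - x^-1) * (0 - 1) - ((x + 1)^-1 - 0 - x^-1) = relJ_gen'' x).
by rewrite /relJ_gen''; field; rewrite !gt_eqF ?addr_gt0.
Qed.

(** * The generator of the relative information of type [s] *)

(** For [s = 0] the second branch is the zero function, so this generates
    [Phi s] only for [s != 0]. *)
Definition Phi_gen (K : realType) (s x : K) : K :=
  if s == 1 then x * ln x else (s * (s - 1))^-1 * (x `^ s - 1).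
Definition Phi_gen' (K : realType) (s x : K) : K :=
  if s == 1 then ln x + 1 else (s - 1)^-1 * x `^ (s - 1).

Lemma is_derive_Phi_gen (K : realType) (s x : K) : s != 0 -> 0 < x ->
  is_derive x 1 (Phi_gen s) (Phi_gen' s x).
Proof.
rewrite /Phi_gen /Phi_gen' => s0 x0; have [_|s1] := eqVneq s 1.
- apply: is_derive_eq (is_deriveM (is_derive_id x 1) (is_derive1_ln x0)) _.
  by rewrite /GRing.scale/= mulr1 divff ?gt_eqF// addrC.
- apply: is_derive_eq (is_deriveZ (s * (s - 1))^-1 (is_deriveB (is_derive1_powR s x0)
    (is_derive_cst (1 : K) x 1))) _.
  by rewrite /GRing.scale/=; field; rewrite subr_eq0 s1.
Qed.

Lemma is_derive_Phi_gen' (K : realType) (s x : K) : 0 < x ->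
  is_derive x 1 (Phi_gen' s) (x `^ (s - 2)).
Proof.
rewrite /Phi_gen' => x0; have [->|s1] := eqVneq s 1.
- apply: is_derive_eq (is_deriveD (is_derive1_ln x0) (is_derive_cst (1 : K) x 1)) _.
  by rewrite addr0 (_ : 1 - 2 = -1 :> K) ?powR_inv1 ?ltW//; ring.
- apply: is_derive_eq (is_deriveZ (s - 1)^-1 (is_derive1_powR (s - 1) x0)) _.
  rewrite /GRing.scale/= mulrA mulVf ?subr_eq0// mul1r; congr (_ `^ _); ring.
Qed.

Lemma csiszar_relJ_gen (K : realType) (n : nat) (P Q : 'I_n -> K) :
  (forall i, 0 < P i) -> (forall i, 0 < Q i) ->
  csiszar (@relJ_gen K) P Q = relJ Q P.
Proof.
move=> P0 Q0; apply: eq_bigr => i _.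
have PQ0 : 0 < P i / Q i by rewrite divr_gt0.
have QE : Q i * (1 - P i / Q i) = Q i - P i by field; rewrite gt_eqF.
rewrite /relJ_gen mulrA QE.
rewrite -!ln_div ?posrE ?divr_gt0 ?addr_gt0//; congr (_ * ln _).
by field; rewrite !gt_eqF.
Qed.

Lemma csiszar_Phi_gen (K : realType) (n : nat) (s : K) (P Q : 'I_n -> K) :
  s != 0 -> (forall i, 0 < P i) -> Gamma Q ->
  csiszar (Phi_gen s) P Q = Phi s P Q.
Proof.
move=> s0 P0 [Q0 Q1]; rewrite /csiszar /Phi_gen /Phi (negPf s0).
have [_|s1] := eqVneq s 1.
  by apply: eq_bigr => i _; rewrite mulrA (mulrC (Q i)) divfK ?gt_eqF.
transitivity ((s * (s - 1))^-1 * \sum_i (P i `^ s * Q i `^ (1 - s) - Q i)).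
  2: by rewrite sumrB Q1.
rewrite mulr_sumr; apply: eq_bigr => i _.
rewrite mulrCA; congr (_ * _); rewrite mulrBr mulr1 powRM ?invr_ge0 ?ltW//.
rewrite powRB ?(gt_eqF (Q0 i)) ?implybT// powRr1 ?ltW//.
rewrite -powR_inv1 ?ltW// -powRrM mulN1r powRN; ring.
Qed.

(** * The quotient of the second derivatives *)

Definition ratio (K : realType) (s x : K) : K :=
  x `^ (- s) * (3 * x + 1) / (x + 1) ^+ 2.
Definition ratio' (K : realType) (s x : K) : K :=
  x `^ (- s - 1) / (x + 1) ^+ 3 *
  (x * (1 - 3 * x) - s * ((3 * x + 1) * (x + 1))).

Lemma relJ_gen''E (K : realType) (s x : K) : 0 < x ->
  relJ_gen'' x = ratio s x * x `^ (s - 2).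
Proof.
move=> x0; rewrite /ratio -!mulrA [RHS]mulrC -!mulrA -powRD ?(gt_eqF x0) ?implybT//.
rewrite addrAC subrr sub0r powR_invn ?ltW// /relJ_gen''.
by field; rewrite !gt_eqF ?addr_gt0.
Qed.

Lemma is_derive_ratio (K : realType) (s x : K) : 0 < x ->
  is_derive x 1 (ratio s) (ratio' s x).
Proof.
move=> x0.
have dD1 := is_deriveD (is_derive_id x 1) (is_derive_cst (1 : K) x 1).
have dD1X := is_deriveX 2 dD1.
have x10 : (x + 1) ^+ 2 != 0 by rewrite expf_neq0 ?gt_eqF ?addr_gt0.
have dV := is_deriveV (f := (id + cst 1) ^+ 2) x10 dD1X.
have d3 := is_deriveD (is_deriveZ 3 (is_derive_id x 1)) (is_derive_cst (1 : K) x 1).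
apply: is_derive_eq (is_deriveM (is_deriveM (is_derive1_powR (- s) x0) d3) dV) _.
change (x `^ (- s) * (3 * x + 1) *
    (- (x + 1) ^+ 2 ^- 2 * (2 * (x + 1) ^+ 1 * (1 + 0)))
  + ((x + 1) ^+ 2)^-1 * (x `^ (- s) * (3 * 1 + 0)
    + (3 * x + 1) * (- s * x `^ (- s - 1))) = ratio' s x).
have -> : x `^ (- s) = x * x `^ (- s - 1).
  rewrite -[X in X * _]powRr1 ?ltW// -powRD ?(gt_eqF x0) ?implybT//.
  by congr (_ `^ _); ring.
by rewrite /ratio'; field; rewrite gt_eqF ?addr_gt0.
Qed.

Lemma ratio'_factor_ge0 (K : realType) (s x : K) : 0 < x ->
  0 <= x `^ (- s - 1) / (x + 1) ^+ 3.
Proof. by move=> x0; rewrite divr_ge0 ?powR_ge0// exprn_ge0// addr_ge0// ltW. Qed.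

(** Since [x * (1 - 3 * x) + (3 * x + 1) * (x + 1) = 5 * x + 1], the bracket in
    [ratio'] is positive as soon as [- s >= 1]. *)
Lemma ratio_nondecreasing (K : realType) (s a b : K) :
  s <= -1 -> 0 < a -> a <= b -> ratio s a <= ratio s b.
Proof.
move=> s1 a0 ab; apply: (nondecreasing_pos (@is_derive_ratio K s) a0 ab) => x /andP[ax _]; have x0 : 0 < x by exact: lt_le_trans ax.
by rewrite mulr_ge0 ?ratio'_factor_ge0//; nra.
Qed.

(** Since [(3 * x + 1) * (x + 1) - 4 * x * (1 - 3 * x) = 15 * x ^+ 2 + 1], the
    bracket in [ratio'] is negative as soon as [s >= 1 / 4]. *)
Lemma ratio_nonincreasing (K : realType) (s a b : K) :
  1 / 4 <= s -> 0 < a -> a <= b -> ratio s b <= ratio s a.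
Proof.
move=> s4 a0 ab; rewrite -lerN2.
have dN (x : K) : 0 < x -> is_derive x 1 (- ratio s) (- ratio' s x).
  by move=> x0; apply: is_deriveN; exact: is_derive_ratio.
apply: (nondecreasing_pos dN a0 ab) => x /andP[ax _].
have x0 : 0 < x by exact: lt_le_trans ax.
by rewrite -mulrN mulr_ge0 ?ratio'_factor_ge0//; nra.
Qed.

(** * The comparison *)

(** Multiplying bounds on [ratio s] by the second derivative [x `^ (s - 2)] of
    [Phi_gen s] turns them into bounds on the second derivative of
    [relJ_gen]. *)
Lemma relJ_between (K : realType) (n : nat) (P Q : 'I_n -> K) (r R s a b : K) :
  Gamma P -> Gamma Q -> 0 < r -> (forall i, r <= P i / Q i <= R) -> s != 0 ->
  (forall t : K, r <= t <= R -> a <= ratio s t <= b) ->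
  a * Phi s P Q <= relJ Q P /\ relJ Q P <= b * Phi s P Q.
Proof.
move=> hP hQ r0 PQ s0 ab; have [P0 _] := hP; have [Q0 _] := hQ.
rewrite -csiszar_relJ_gen// -csiszar_Phi_gen//; apply/andP.
apply: (csiszar_compare hP hQ r0 PQ (@is_derive_relJ_gen K)
  (@is_derive_relJ_gen' K) (fun t => is_derive_Phi_gen s0)
  (@is_derive_Phi_gen' K s)).
- by rewrite /relJ_gen subrr mul0r.
- by rewrite /Phi_gen ln1 mulr0 powR1 subrr mulr0 if_same.
- move=> t rtR; have /andP[rt _] := rtR.
  have t0 : 0 < t by exact: lt_le_trans rt.
  have /andP[at_ tb] := ab t rtR.
  by rewrite (relJ_gen''E s t0) !ler_wpM2r ?powR_ge0.
Qed.

Theorem theorem4p2 (K : realType) (n : nat) (hn : (2 <= n)%N)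
    (P Q : 'I_n -> K) (hP : Gamma P) (hQ : Gamma Q)
    (r R : K) (hr : 0 < r) (hrR : forall i, r <= P i / Q i /\ P i / Q i <= R) :
  (forall s : K, s <= -1 ->
     r `^ (- s) * (3 * r + 1) / (r + 1) ^+ 2 * Phi s P Q <= relJ Q P /\
     relJ Q P <= R `^ (- s) * (3 * R + 1) / (R + 1) ^+ 2 * Phi s P Q) /\
  (forall s : K, 1 / 4 <= s ->
     R `^ (- s) * (3 * R + 1) / (R + 1) ^+ 2 * Phi s P Q <= relJ Q P /\
     relJ Q P <= r `^ (- s) * (3 * r + 1) / (r + 1) ^+ 2 * Phi s P Q).
Proof.
have PQ i : r <= P i / Q i <= R by apply/andP; exact: hrR.
split=> s hs; apply: (relJ_between hP hQ hr PQ).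
- by apply/eqP => s0; lra.
- move=> t /andP[rt tR]; have t0 : 0 < t by exact: lt_le_trans rt.
  by apply/andP; split; apply: ratio_nondecreasing.
- by apply/eqP => s0; lra.
- move=> t /andP[rt tR]; have t0 : 0 < t by exact: lt_le_trans rt.
  by apply/andP; split; apply: ratio_nonincreasing.
Qed.
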